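(* Let $\alpha>1$, let $\mathbb O_s$ be the split-octonion algebra over $\mathbb R$, and let $e_1,\dots,e_7$ be a standard basis of $\mathrm{Im}(\mathbb O_s)$. Consider the Banach space $$\mathfrak g=\Big\{X=\sum_{i=1}^7\sum_{n\ge0}a_{i,n}\,e_iS^n:\ \|X\|=\sum_{i,n}|a_{i,n}|\,\alpha^n<\infty\Big\}$$ with bracket given on generators by $$[e_iS^m,e_jS^n]:=(e_ie_j-e_je_i)\,S^{m+n}.$$ Then $\mathfrak g$ is a special Banach--Malcev algebra which is not a Lie algebra, and its bracket continuity constant satisfies $B=2$. Hence, for any bound $K\ge1$ on the absolute values of the BCH coefficients, the radius $\rho=\frac1{4KB}$ equals $\frac1{8K}$.
   Context: The split-octonion algebra $\mathbb O_s$ is the 8-dimensional real alternative, non-associative algebra of Zorn vector-matrices $\begin{pmatrix}a&u\\ v&b\end{pmatrix}$, $a,b\in\mathbb R$, $u,v\in\mathbb R^3$, with the classical Zorn product $$\begin{pmatrix}a&u\\ v&b\end{pmatrix}\begin{pmatrix}a'&u'\\ v'&b'\end{pmatrix}=\begin{pmatrix}aa'+u\cdot v'&au'+b'u-v\times v'\\ a'v+bv'+u\times u'&bb'+v\cdot u'\end{pmatrix}.$$ $\mathrm{Im}(\mathbb O_s)$ is the 7-dimensional subspace $a+b=0$. A standard basis $e_1,\dots,e_7$ of imaginary units satisfies $e_i^2=\pm1$ and, for $i\ne j$, $e_ie_j=-e_je_i=\pm e_k$ for some $k$ determined by the (split) Fano-plane incidence; thus $e_ie_j-e_je_i=c_{ij}e_k$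 with $c_{ij}\in\{0,\pm2\}$. $S$ is a formal shift symbol, so $S^n$, $n\ge0$, are formal generators, and the bracket is extended bilinearly and continuously. A Malcev algebra is a vector space with a bilinear bracket satisfying $[x,y]=-[y,x]$ and $[[x,y],[x,z]]=[[[x,y],z],x]+[[[y,z],x],x]+[[[z,x],x],y]$. A Banach--Malcev algebra is a Malcev algebra complete for a norm making the bracket continuous. It is special if it embeds, as a Malcev algebra, into an alternative algebra equipped with the commutator bracket $xy-yx$. The bracket continuity constant here is $$B=\sup_{(i,m),(j,n)}\frac{\|[e_iS^m,e_jS^n]\|}{\|e_iS^m\|\,\|e_jS^n\|},$$ which gives $\|[X,Y]\|\le B\|X\|\|Y\|$ for all $X,Y\in\mathfrak g$. The BCH coefficients $\alpha_T\in\mathbb Q$ are the fixed classical coefficients in the expansion of $\log(\exp(x)\exp(y))$ as a sum of terms $\alpha_T[x,y]_T$, where $T$ ranges over full binary trees with leaves labeled by $x$ or $y$ and $[x,y]_T$ is the iterated bracket prescribed by $T$; $K\ge1$ is a number with $|\alpha_T|\le K$ for all $T$. *)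

(* Defs.v *)
From HB Require Import structures.
From mathcomp Require Import all_boot all_order all_algebra.
From mathcomp Require Import all_classical all_reals all_analysis.

Set Implicit Arguments.
Unset Strict Implicit.
Unset Printing Implicit Defensive.

Import Order.TTheory GRing.Theory Num.Theory.
Import numFieldNormedType.Exports.

Local Open Scope classical_set_scope.
Local Open Scope ring_scope.

(** * Nonassociative algebras *)

Definition bilinear_map (R : pzRingType) (V W : lmodType R) (f : V -> V -> W) :=
  (forall y, linear (f^~ y)) /\ (forall x, linear (f x)).

Definition malcev_algebra (R : pzRingType) (V : lmodType R) (br : V -> V -> V) :=
  [/\ bilinear_map br,
      forall x y, br x y = - br y x &
      forall x y z, br (br x y) (br x z)
        = br (br (br x y) z) x + br (br (br y z) x) x + br (br (br z x) x) y].

Definition lie_algebra (R : pzRingType) (V : lmodType R) (br : V -> V -> V) :=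
  [/\ bilinear_map br,
      forall x, br x x = 0 &
      forall x y z, br x (br y z) + br y (br z x) + br z (br x y) = 0].

Definition alternative_algebra (R : pzRingType) (A : lmodType R)
    (mul : A -> A -> A) :=
  [/\ bilinear_map mul,
      forall x y, mul x (mul x y) = mul (mul x x) y &
      forall x y, mul (mul y x) x = mul y (mul x x)].

Definition special (R : pzRingType) (V : lmodType R) (br : V -> V -> V) :=
  exists (A : lmodType R) (mul : A -> A -> A) (f : {linear V -> A}),
    [/\ alternative_algebra mul, injective f &
        forall x y, f (br x y) = mul (f x) (f y) - mul (f y) (f x)].

Definition complete_space (T : puniformType) :=
  forall F : set_system T, ProperFilter F -> cauchy F -> cvg F.

Definition continuous_bracket (R : numFieldType) (V : normedModType R)
    (br : V -> V -> V) :=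
  continuous (fun p : V * V => br p.1 p.2).

Definition banach_malcev_algebra (R : numFieldType) (V : normedModType R)
    (br : V -> V -> V) :=
  [/\ malcev_algebra br, complete_space V & continuous_bracket br].

(** * Split octonions *)

Section SplitOctonions.
Variable R : realType.

(* [(a, u, v, b)] is the Zorn vector-matrix with rows [(a u)] and [(v b)]. *)
Definition octs : Type := (R^o * 'rV[R]_3 * 'rV[R]_3 * R^o)%type.
HB.instance Definition _ := Vector.on octs.

Definition Zorn (a : R) (u v : 'rV[R]_3) (b : R) : octs := (a, u, v, b).
Definition octs_a (x : octs) : R := x.1.1.1.
Definition octs_u (x : octs) : 'rV[R]_3 := x.1.1.2.
Definition octs_v (x : octs) : 'rV[R]_3 := x.1.2.
Definition octs_b (x : octs) : R := x.2.

Definition dotmul (u v : 'rV[R]_3) : R := \sum_(k < 3) u 0 k * v 0 k.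

(* The indices [k + 1] and [k + 2] are taken modulo 3. *)
Definition crossmul (u v : 'rV[R]_3) : 'rV[R]_3 :=
  \row_(k < 3) (u 0 (k + 1) * v 0 (k + 2) - u 0 (k + 2) * v 0 (k + 1)).

Definition octs_mul (x y : octs) : octs :=
  let: (a, u, v, b) := (octs_a x, octs_u x, octs_v x, octs_b x) in
  let: (a', u', v', b') := (octs_a y, octs_u y, octs_v y, octs_b y) in
  Zorn (a * a' + dotmul u v')
       (a *: u' + b' *: u - crossmul v v')
       (a' *: v + b *: v' + crossmul u u')
       (b * b' + dotmul v u').

Definition octs_one : octs := Zorn 1 0 0 1.

Definition octs_trace (x : octs) : R^o := octs_a x + octs_b x.

Lemma octs_trace_is_linear : linear octs_trace.
Proof.
by move=> c x y; rewrite /octs_trace /octs_a /octs_b /= scalerDr addrACA.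
Qed.

HB.instance Definition _ :=
  GRing.isLinear.Build R octs R^o *:%R octs_trace octs_trace_is_linear.

Definition Im_octs : {vspace octs} := lker (linfun octs_trace).

Definition fano_plane (L : {set {set 'I_7}}) :=
  (forall l, l \in L -> #|l| = 3%N) /\
  (forall i j : 'I_7, i != j -> #|[set l in L | (i \in l) && (j \in l)]| = 1%N).

Definition standard_basis (e : 7.-tuple octs) :=
  [/\ basis_of Im_octs e,
      forall i : 'I_7, octs_mul e`_i e`_i = octs_one
                    \/ octs_mul e`_i e`_i = - octs_one &
      exists2 L, fano_plane L &
        forall i j : 'I_7, i != j -> exists k : 'I_7,
          [/\ [set i; j; k]%SET \in L,
              octs_mul e`_i e`_j = - octs_mul e`_j e`_i &
              octs_mul e`_i e`_j = e`_k \/ octs_mul e`_i e`_j = - e`_k]].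

End SplitOctonions.

(** * The weighted l^1 space of formal series in the symbols [e_i S^n] *)

Section WeightedL1.
Variables (R : realType) (alpha : R).

Definition wl1_enorm (a : 'I_7 * nat -> R^o) : \bar R :=
  \esum_(p in [set: 'I_7 * nat]) (`|a p| * alpha ^+ p.2)%:E.

(* The proof argument is used only to infer closure under linear operations. *)
Definition wl1_pred of 1 < alpha : {pred ('I_7 * nat -> R^o)} :=
  fun a => (wl1_enorm a < +oo)%E.

Hypothesis alpha_gt1 : 1 < alpha.

Let term_ge0 (a : 'I_7 * nat -> R^o) p :
  (0 <= (`|a p| * alpha ^+ p.2)%:E)%E.
Proof.
by rewrite lee_fin mulr_ge0// exprn_ge0// ltW// (lt_trans ltr01).
Qed.

Lemma wl1_enorm_ge0 a : (0 <= wl1_enorm a)%E.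
Proof. by apply: esum_ge0 => p _; exact: term_ge0. Qed.

Lemma wl1_enormD a b :
  (wl1_enorm (a + b)%R <= wl1_enorm a + wl1_enorm b)%E.
Proof.
rewrite /wl1_enorm -esumD; [|by move=> *; exact: term_ge0..].
apply: le_esum => p _; rewrite -EFinD lee_fin -mulrDl ler_wpM2r ?ler_normD//.
by rewrite exprn_ge0// ltW// (lt_trans ltr01).
Qed.

Lemma wl1_enormZ_le c a : (wl1_enorm (c *: a)%R <= `|c|%:E * wl1_enorm a)%E.
Proof.
apply: ge_ereal_sup => _ [A finA <-].
rewrite (eq_fsbigr (fun p => (`|c|%:E * (`|a p| * alpha ^+ p.2)%:E)%E)); last first.
  by move=> p _; rewrite -EFinM mulrA -normrM.
rewrite -ge0_mule_fsumr; last by move=> p; exact: term_ge0.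
by rewrite lee_wpmul2l ?lee_fin//; apply: ereal_sup_ubound; exists A.
Qed.

Lemma wl1_enorm0 : wl1_enorm 0 = 0%E.
Proof. by apply: esum1 => p _; rewrite normr0 mul0r. Qed.

Lemma wl1_enormZ c a : (wl1_enorm (c *: a)%R = `|c|%:E * wl1_enorm a)%E.
Proof.
have [->|c0] := eqVneq c 0; first by rewrite scale0r normr0 mul0e wl1_enorm0.
apply/eqP; rewrite eq_le wl1_enormZ_le /=.
have := wl1_enormZ_le c^-1 (c *: a).
rewrite scalerA mulVf// scale1r => /(lee_wpmul2l (x := `|c|%:E)).
rewrite lee_fin normr_ge0 => /(_ isT); rewrite muleA -EFinM -normrM.
by rewrite mulfV// normr1 mul1e.
Qed.

Lemma wl1_enorm_eq0 a : wl1_enorm a = 0%E -> a = 0.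
Proof.
move=> a0; apply/funext => p.
have : ((`|a p| * alpha ^+ p.2)%:E <= 0)%E.
  rewrite -a0; apply: esum_ge; exists [set p]; first by split.
  by rewrite fsbig_set1.
rewrite lee_fin pmulr_lle0 ?exprn_gt0 ?(lt_trans ltr01)//.
by rewrite normr_le0 => /eqP.
Qed.

Lemma wl1_submod_closed : submod_closed (wl1_pred alpha_gt1).
Proof.
split=> [|c a b]; rewrite !unfold_in ?wl1_enorm0 ?ltry// => fa fb.
apply: le_lt_trans (wl1_enormD _ _) _; rewrite wl1_enormZ lte_add_pinfty//.
by rewrite lte_mul_pinfty.
Qed.

HB.instance Definition _ :=
  GRing.isSubmodClosed.Build R ('I_7 * nat -> R^o) (wl1_pred alpha_gt1)
    wl1_submod_closed.

End WeightedL1.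

(* [coef X (i, n)] is the coefficient of [e_i S^n] in [X].  The hypothesis on
   [alpha] is a parameter because the norm needs it. *)
Record wl1 (R : realType) (alpha : R) (alpha_gt1 : 1 < alpha) := Wl1 {
  coef : 'I_7 * nat -> R^o;
  coef_wl1 : coef \in wl1_pred alpha_gt1 }.

Section WeightedL1Space.
Variables (R : realType) (alpha : R) (alpha_gt1 : 1 < alpha).
Local Notation wl1 := (wl1 alpha_gt1).

HB.instance Definition _ := [isSub for @coef R alpha alpha_gt1].
HB.instance Definition _ := [Choice of wl1 by <:].
HB.instance Definition _ := [SubChoice_isSubLmodule of wl1 by <:].

Definition wl1_norm (X : wl1) : R := fine (wl1_enorm alpha (coef X)).

Lemma wl1_normE X : (wl1_norm X)%:E = wl1_enorm alpha (coef X).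
Proof.
rewrite fineK// fin_numE gt_eqF ?lt_eqF//.
- exact: coef_wl1.
- by rewrite (lt_le_trans (ltNyr 0))// wl1_enorm_ge0.
Qed.

Lemma ler_wl1_normD X Y : wl1_norm (X + Y) <= wl1_norm X + wl1_norm Y.
Proof. by rewrite -lee_fin EFinD !wl1_normE; exact: wl1_enormD. Qed.

Lemma wl1_normZ c X : wl1_norm (c *: X) = `|c| * wl1_norm X.
Proof. by apply: EFin_inj; rewrite EFinM !wl1_normE; exact: wl1_enormZ. Qed.

Lemma wl1_norm_eq0 X : wl1_norm X = 0 -> X = 0.
Proof.
move=> X0; apply/val_inj/(wl1_enorm_eq0 alpha_gt1).
by rewrite -wl1_normE X0.
Qed.

HB.instance Definition _ :=
  Lmodule_isNormed.Build R wl1 ler_wl1_normD wl1_normZ wl1_norm_eq0.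

Lemma wl1_enorm_delta (q : 'I_7 * nat) :
  wl1_enorm alpha (fun p => (p == q)%:R) = (alpha ^+ q.2)%:E.
Proof.
rewrite /wl1_enorm (esumID [set q])/=; last first.
  move=> p _; rewrite lee_fin mulr_ge0// exprn_ge0//.
  by rewrite ltW// (lt_trans ltr01).
rewrite setTI esum_set1; last first.
  by rewrite lee_fin mulr_ge0// exprn_ge0// ltW// (lt_trans ltr01).
rewrite eqxx normr1 mul1r esum1 ?adde0// => p [_] /= /eqP/negbTE ->.
by rewrite normr0 mul0r.
Qed.

Lemma delta_wl1 (q : 'I_7 * nat) :
  (fun p => (p == q)%:R : R^o) \in wl1_pred alpha_gt1.
Proof. by rewrite unfold_in wl1_enorm_delta ltry. Qed.

(* The generator [e_i S^n]. *)
Definition gen (i : 'I_7) (n : nat) : wl1 := Wl1 (delta_wl1 (i, n)).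

(* [z S^n], for [z] in the span of the basis [e]. *)
Definition oct_shift (e : 7.-tuple (octs R)) (z : octs R) (n : nat) : wl1 :=
  \sum_(k < 7) coord e k z *: gen k n.

Definition shift_bracket (e : 7.-tuple (octs R)) (br : wl1 -> wl1 -> wl1) :=
  [/\ bilinear_map br,
      continuous_bracket br &
      forall i j m n, br (gen i m) (gen j n)
        = oct_shift e (octs_mul e`_i e`_j - octs_mul e`_j e`_i) (m + n)].

Definition bracket_constant (br : wl1 -> wl1 -> wl1) : R :=
  sup [set r | exists i m j n,
    r = `|br (gen i m) (gen j n)| / (`|gen i m| * `|gen j n|)].

End WeightedL1Space.

(** * Baker-Campbell-Hausdorff coefficients *)

(* Full binary trees; the leaves [Leaf false] and [Leaf true] are labeled by
   [x] and [y] respectively. *)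
Inductive tree := Leaf of bool | Node of tree & tree.

HB.instance Definition _ := gen_eqMixin tree.
HB.instance Definition _ := gen_choiceMixin tree.

Fixpoint leaves (t : tree) : nat :=
  if t is Node l r then (leaves l + leaves r)%N else 1%N.

(* Formal power series in the noncommuting variables [x] and [y], given by
   the coefficients of the words in these variables. *)
Definition ncseries := seq bool -> rat.

Definition nc_var (b : bool) : ncseries := fun w => (w == [:: b])%:R.

Definition nc_one : ncseries := fun w => (w == [::])%:R.

Definition nc_mul (f g : ncseries) : ncseries := fun w =>
  \sum_(i < (size w).+1) f (take i w) * g (drop i w).

Definition nc_pow (f : ncseries) (k : nat) : ncseries :=
  iter k (nc_mul f) nc_one.

(* Exponential of a series [f] without constant term: only the powers
   [f ^ k] with [k <= size w] contribute to the coefficient of [w]. *)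
Definition nc_exp (f : ncseries) : ncseries := fun w =>
  \sum_(k < (size w).+1) nc_pow f k w / k`!%:R.

(* Logarithm of a series [f] with constant term 1; truncated as above. *)
Definition nc_log (f : ncseries) : ncseries := fun w =>
  \sum_(1 <= k < (size w).+1)
    (-1) ^+ k.+1 / k%:R * nc_pow (fun v => f v - nc_one v) k w.

Fixpoint nc_bracket (t : tree) : ncseries :=
  match t with
  | Leaf b => nc_var b
  | Node l r => fun w =>
      nc_mul (nc_bracket l) (nc_bracket r) w
      - nc_mul (nc_bracket r) (nc_bracket l) w
  end.

(* [log (exp x exp y) = \sum_t c t [x, y]_t].  As [[x, y]_t] is homogeneous of
   degree [leaves t], only the finitely many trees with [size w] leaves
   contribute to the coefficient of [w]. *)
Definition bch_coefficients (c : tree -> rat) :=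
  forall w : seq bool,
    nc_log (nc_mul (nc_exp (nc_var false)) (nc_exp (nc_var true))) w
    = \sum_(t \in [set t | leaves t = size w]) c t * nc_bracket t w.

Definition bch_radius (R : realType) (K B : R) : R := (4 * K * B)^-1.

(* Main.v *)
From HB Require Import structures.
Require Import Defs.
From mathcomp Require Import all_boot all_order all_algebra.
From mathcomp Require Import all_classical all_reals all_analysis.
From mathcomp Require Import ring lra zify.

Import Order.TTheory GRing.Theory Num.Theory.
Import numFieldNormedType.Exports.

Local Open Scope classical_set_scope.
Local Open Scope ring_scope.

Set Implicit Arguments.
Unset Strict Implicit.
Unset Printing Implicit Defensive.

(** The bracket is realised inside the formal power series in one variable with
coefficients in the split octonions.  An element of the weighted l^1 space is
sent to the series whose coefficient of [S^n] is [\sum_k a_(k, n) e_k]; the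
Cauchy product of such series is alternative because the octonion product is
([convolution_alternative], [octs_alternative]), and the commutator of an
alternative product satisfies the Malcev identity ([commutator_malcev]).  The
commutator of two octonions has trace zero, so the commutator of two series has
coefficients in the span of [e] and can be read back in coordinates: this
defines [octonion_bracket], which is special by construction and Malcev because
the embedding [octonion_series] is injective.

The constant 2 comes from the basis: [e_i e_j - e_j e_i] is [0] or
[+- 2 e_k], so the commutator at most doubles the product of the coordinate
l^1 norms ([coord_norm_commutator]).  Since the weights [alpha ^ n] are
multiplicative, the Cauchy product does not increase this factor, which gives
[`|br X Y| <= 2 `|X| `|Y|]; equality holds on two
generators with distinct basis vectors.

Finite combinations of generators are dense, so a continuous bilinear map is
determined by its values on generators ([shift_bracket_unique]).  The Jacobi
identity fails because on [S^0] the bracket restricts to the commutator of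
imaginary octonions, whose Jacobiator does not vanish on the three unit vectors
of the upper right corner ([jacobiator_Im_neq0]).  The radius is then a
computation from [B = 2]. *)

(** * Bilinear maps *)

Section BilinearMaps.
Variables (R : pzRingType) (V W : lmodType R) (f : V -> V -> W).
Hypothesis f_bil : bilinear_map f.

Definition linear_left (y : V) : {linear V -> W} :=
  HB.pack (f^~ y) (GRing.isLinear.Build R V W *:%R (f^~ y) (f_bil.1 y)).

Definition linear_right (x : V) : {linear V -> W} :=
  HB.pack (f x) (GRing.isLinear.Build R V W *:%R (f x) (f_bil.2 x)).

Lemma bilDl x x' y : f (x + x') y = f x y + f x' y.
Proof. exact: (linearD (linear_left y)). Qed.

Lemma bilDr x y y' : f x (y + y') = f x y + f x y'.
Proof. exact: (linearD (linear_right x)). Qed.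

Lemma bilNl x y : f (- x) y = - f x y.
Proof. exact: (linearN (linear_left y)). Qed.

Lemma bilNr x y : f x (- y) = - f x y.
Proof. exact: (linearN (linear_right x)). Qed.

Lemma bilBl x x' y : f (x - x') y = f x y - f x' y.
Proof. exact: (linearB (linear_left y)). Qed.

Lemma bilBr x y y' : f x (y - y') = f x y - f x y'.
Proof. exact: (linearB (linear_right x)). Qed.

Lemma bil0l y : f 0 y = 0.
Proof. exact: (linear0 (linear_left y)). Qed.

Lemma bil0r x : f x 0 = 0.
Proof. exact: (linear0 (linear_right x)). Qed.

Lemma bilZl c x y : f (c *: x) y = c *: f x y.
Proof. exact: (linearZ_LR (linear_left y)). Qed.

Lemma bilZr c x y : f x (c *: y) = c *: f x y.
Proof. exact: (linearZ_LR (linear_right x)). Qed.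

Lemma bil_suml I r (P : pred I) (F : I -> V) y :
  f (\sum_(i <- r | P i) F i) y = \sum_(i <- r | P i) f (F i) y.
Proof. exact: (linear_sum (linear_left y)). Qed.

Lemma bil_sumr I r (P : pred I) (F : I -> V) x :
  f x (\sum_(i <- r | P i) F i) = \sum_(i <- r | P i) f x (F i).
Proof. exact: (linear_sum (linear_right x)). Qed.

End BilinearMaps.

(** * Alternative algebras *)

Section AlternativeAlgebras.
Variables (R : pzRingType) (A : lmodType R) (mul : A -> A -> A).

Local Notation "x ** y" := (mul x y) (at level 40, left associativity).

Definition commutator x y := x ** y - y ** x.

Definition associator x y z := (x ** y) ** z - x ** (y ** z).

Local Notation com := commutator.
Local Notation asc := associator.

Hypothesis mul_bil : bilinear_map mul.

Lemma commutator_bilinear : bilinear_map com.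
Proof.
split=> [y a u v|x a u v]; rewrite /com !(bilDl mul_bil, bilDr mul_bil);
  by rewrite !(bilZl mul_bil, bilZr mul_bil) opprD addrACA -scalerBr.
Qed.

Lemma commutatorC x y : com x y = - com y x.
Proof. by rewrite /com opprB. Qed.

Lemma ascDl x x' y z : asc (x + x') y z = asc x y z + asc x' y z.
Proof. by rewrite /asc !(bilDl mul_bil) opprD addrACA. Qed.

Lemma ascDm x y y' z : asc x (y + y') z = asc x y z + asc x y' z.
Proof.
by rewrite /asc !(bilDl mul_bil, bilDr mul_bil) opprD addrACA.
Qed.

Lemma ascDr x y z z' : asc x y (z + z') = asc x y z + asc x y z'.
Proof. by rewrite /asc !(bilDr mul_bil) opprD addrACA. Qed.

Lemma ascBr x y z z' : asc x y (z - z') = asc x y z - asc x y z'.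
Proof.
by rewrite ascDr; congr (_ + _); rewrite /asc !(bilNr mul_bil) opprK opprB addrC.
Qed.

(** Valid in every nonassociative algebra: the five ways of bracketing four factors
cancel in pairs. *)
Lemma teichmuller w x y z :
  asc (w ** x) y z - asc w (x ** y) z + asc w x (y ** z) =
  w ** asc x y z + asc w x y ** z.
Proof.
rewrite /asc !(bilBl mul_bil, bilBr mul_bil) !(opprB, opprD, opprK, addrA).
(* The two occurrences of [(w x) (y z)] are the second and fifth summands. *)
by rewrite [LHS](ACl (3*6*1*4*(2*5)))/= addNr addr0.
Qed.

Definition jacobiator x y z := com (com x y) z + com (com y z) x + com (com z x) y.

(** Both sides expand to the same twelve signed monomials, so this needs only
bilinearity. *)
Lemma jacobiatorE x y z :
  jacobiator x y z =
  (asc x y z + asc y z x + asc z x y) - (asc y x z + asc x z y + asc z y x).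
Proof.
rewrite /jacobiator /com /asc !(bilBl mul_bil, bilBr mul_bil).
rewrite !(opprB, opprD, opprK, addrA).
by rewrite [LHS](ACl (1*8*5*12*9*4*11*2*7*10*3*6)).
Qed.

Hypothesis left_alternative : forall x y, x ** (x ** y) = (x ** x) ** y.
Hypothesis right_alternative : forall x y, (y ** x) ** x = y ** (x ** x).

Lemma asc_left0 x y : asc x x y = 0.
Proof. by rewrite /asc left_alternative subrr. Qed.

Lemma asc_right0 x y : asc y x x = 0.
Proof. by rewrite /asc right_alternative subrr. Qed.

(** Linearisation of [asc x x z = 0]; with [asc_swapr], the associator is
alternating. *)
Lemma asc_swapl x y z : asc y x z = - asc x y z.
Proof.
apply/eqP; rewrite -addr_eq0; apply/eqP.
have := asc_left0 (x + y) z.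
by rewrite ascDl !ascDm !asc_left0 add0r addr0 addrC.
Qed.

Lemma asc_swapr x y z : asc x z y = - asc x y z.
Proof.
apply/eqP; rewrite -addr_eq0; apply/eqP.
have := asc_right0 (y + z) x.
by rewrite ascDm !ascDr !asc_right0 add0r addr0 addrC.
Qed.

Lemma asc_rot x y z : asc y z x = asc x y z.
Proof. by rewrite asc_swapr asc_swapl opprK. Qed.

(** An alternating associator is invariant under cyclic permutations and changes
sign under transpositions, so the six terms of [jacobiatorE] are all equal. *)
Lemma alt_jacobiatorE x y z : jacobiator x y z = asc x y z *+ 6.
Proof.
have rot := asc_rot x y z; have rot2 : asc z x y = asc x y z by rewrite -asc_rot.
rewrite jacobiatorE (asc_swapl x y z) (asc_swapr x y z) (asc_swapl y z x) rot rot2.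
by rewrite -!opprD opprK !mulrSr mulr0n add0r !addrA.
Qed.

(** The Teichmuller identity with a repeated first factor.  Comparing this value of
[asc (x ** x) y z] with two other instances yields [asc_mulr] and [asc_mull]. *)
Lemma asc_sqr x y z :
  asc (x ** x) y z = asc x (x ** y) z + x ** asc x y z.
Proof.
have := teichmuller x x y z.
by rewrite !asc_left0 (bil0l mul_bil) !addr0 => /(canRL (subrK _)); rewrite addrC.
Qed.

Lemma asc_flip x y z : asc z y x = - asc x y z.
Proof. by rewrite asc_swapl asc_rot. Qed.

(** With [asc_mull], a form of the Moufang identities: a factor [x] inside the middle
argument leaves an associator that already contains [x]. *)
Lemma asc_mulr x y z : asc x (y ** x) z = x ** asc x y z.
Proof.
have := teichmuller y x x z.
rewrite asc_left0 asc_right0 (bil0l mul_bil) (bil0r mul_bil) addr0.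
rewrite -(asc_rot y (x ** x)) -(asc_rot y x (x ** z)) asc_sqr.
rewrite (asc_swapr x y z) (asc_swapl x (y ** x) z) (bilNr mul_bil).
move: (asc x (x ** z) y) (asc x (y ** x) z) (x ** asc x y z) => u v w.
by rewrite opprB addrA subrK addrC => /subr0_eq ->.
Qed.

Lemma asc_mull x y z : asc x (x ** y) z = asc x y z ** x.
Proof.
have := teichmuller z y x x.
rewrite !asc_right0 (bil0r mul_bil) !add0r.
rewrite (asc_flip (x ** x)) (asc_flip x (y ** x)) (asc_flip x y z) asc_mulr asc_sqr.
rewrite opprK (bilNl mul_bil).
move: (asc x (x ** y) z) (x ** asc x y z) (asc x y z ** x) => u v w.
by rewrite opprD addrCA subrr addr0 => /oppr_inj.
Qed.

(** The Malcev identity is equivalent to [J x y [x, z] = [J x y z, x]].  As [J] is six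
times the associator, this reads [asc x y (xz - zx) = (asc x y z) x - x (asc x y z)],
which is [asc_mull] and [asc_mulr] after a transposition. *)
Lemma commutator_malcev : malcev_algebra com.
Proof.
split=> [||x y z]; [exact: commutator_bilinear|exact: commutatorC|].
have com_bil := commutator_bilinear.
have J_com : jacobiator x y (com x z) = com (jacobiator x y z) x.
  have xz : asc x y (x ** z) = asc x y z ** x.
    by rewrite asc_swapr asc_mull asc_swapr (bilNl mul_bil) opprK.
  have zx : asc x y (z ** x) = x ** asc x y z.
    by rewrite asc_swapr asc_mulr asc_swapr (bilNr mul_bil) opprK.
  rewrite !alt_jacobiatorE [com x z]/com ascBr xz zx -/(com _ _).
  by rewrite -[RHS]/(linear_left com_bil x _) raddfMn.
have comD a b c : com (a + b + c) x = com a x + com b x + com c x.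
  by rewrite 2!(bilDl com_bil).
(* In the expanded identity the term [[[z, x], y], x] occurs on both sides. *)
move: J_com; rewrite /jacobiator comD.
have -> : com y (com x z) = com (com z x) y.
  by rewrite (commutatorC y) (commutatorC x) (bilNl com_bil) opprK.
have -> : com (com (com x z) x) y = - com (com (com z x) x) y.
  by rewrite (commutatorC x z) !(bilNl com_bil).
set a := com (com x y) _; set b := com (com (com z x) y) x; set c := com _ y.
by move=> /(canRL (subrK c)) /(canRL (addrK b)) ->; rewrite addrAC addrK.
Qed.

End AlternativeAlgebras.

(** * Formal power series over an alternative algebra *)

(** The bound [N] is independent of [n], so that sums over several antidiagonals can be
exchanged. *)
Lemma sum_antidiagonal (V : nmodType) (F : nat -> nat -> V) n N : (n < N)%N ->
  \sum_(i < n.+1) F i (n - i)%N = \sum_(i < N) \sum_(j < N | (i + j == n)%N) F i j.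
Proof.
move=> nN; rewrite (big_ord_widen N (fun i => F i (n - i)%N))// big_mkcond.
apply: eq_bigr => i _; rewrite ltnS; case: leqP => [le_in|lt_ni].
  rewrite (eq_bigl (fun j : 'I_N => j == n - i :> nat)%N) => [|j]; last by lia.
  by rewrite (big_ord1_eq _ (F i)) ifT// (leq_ltn_trans (leq_subr _ _)).
by rewrite big1// => j; lia.
Qed.

(** The left-hand side sums the products [u i * v j] over the triangle [i + j < N] of the
square that the right-hand side covers. *)
Lemma sum_convolution_le (R : numDomainType) (u v : nat -> R) N :
  (forall n, 0 <= u n) -> (forall n, 0 <= v n) ->
  \sum_(n < N) \sum_(i < n.+1) u i * v (n - i)%N <= (\sum_(i < N) u i) * \sum_(j < N) v j.
Proof.
move=> u0 v0; rewrite mulr_suml.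
under eq_bigr => n _ do
  rewrite (sum_antidiagonal (fun i j => u i * v j) (ltn_ord n)).
rewrite exchange_big; apply: ler_sum => i _; rewrite mulr_sumr.
under eq_bigr do rewrite big_mkcond.
rewrite exchange_big; apply: ler_sum => j _.
rewrite -big_mkcond; under eq_bigl do rewrite eq_sym.
rewrite (big_ord1_eq +%R (fun=> u i * v j)).
by case: ifP; rewrite ?mulr_ge0.
Qed.

Section PowerSeries.
Variables (R : numFieldType) (A : lmodType R) (mul : A -> A -> A).

Local Notation "x ** y" := (mul x y) (at level 40, left associativity).

Definition convolution (f g : nat -> A) : nat -> A :=
  fun n => \sum_(i < n.+1) f i ** g (n - i)%N.

Hypothesis mul_alt : alternative_algebra mul.

Let mul_bil : bilinear_map mul. Proof. by case: mul_alt. Qed.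

Lemma convolution_bilinear : bilinear_map convolution.
Proof.
split=> [g c f f'|f c g g']; apply/funext => n; rewrite /convolution.
  rewrite [RHS]/GRing.add/= [(c *: _) n]/GRing.scale/= scaler_sumr -big_split.
  by apply: eq_bigr => i _; rewrite (bilDl mul_bil) (bilZl mul_bil).
rewrite [RHS]/GRing.add/= [(c *: _) n]/GRing.scale/= scaler_sumr -big_split.
by apply: eq_bigr => i _; rewrite (bilDr mul_bil) (bilZr mul_bil).
Qed.

(** With [convolution_right], brings both bracketings of a triple product to a sum over
the same index set, so that their difference is a sum of associators. *)
Lemma convolution_left f g h n :
  convolution (convolution f g) h n =
  \sum_(a < n.+1) \sum_(b < n.+1) \sum_(c < n.+1 | (a + b + c == n)%N)
    (f a ** g b) ** h c.
Proof.
rewrite /convolution.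
rewrite (sum_antidiagonal
  (fun i j => (\sum_(k < i.+1) f k ** g (i - k)%N) ** h j) (ltnSn n)).
under eq_bigr => i _.
  rewrite (sum_antidiagonal (fun k l => f k ** g l) (ltn_ord i)).
  under eq_bigr do rewrite (bil_suml mul_bil).
  rewrite exchange_big /=.
  under eq_bigr => a _.
    under eq_bigr do rewrite (bil_suml mul_bil).
    rewrite exchange_big big_mkcond /=.
    over.
  over.
rewrite exchange_big; apply: eq_bigr => a _.
rewrite exchange_big; apply: eq_bigr => b _.
rewrite -big_mkcond; under eq_bigl do rewrite eq_sym.
rewrite (big_ord1_eq _
  (fun i => \sum_(c < n.+1 | (i + c == n)%N) (f a ** g b) ** h c)).
by case: ltnP => // ab; rewrite big1// => c; lia.
Qed.

Lemma convolution_right f g h n :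
  convolution f (convolution g h) n =
  \sum_(a < n.+1) \sum_(b < n.+1) \sum_(c < n.+1 | (a + b + c == n)%N)
    f a ** (g b ** h c).
Proof.
rewrite /convolution.
rewrite (sum_antidiagonal
  (fun i j => f i ** (\sum_(k < j.+1) g k ** h (j - k)%N)) (ltnSn n)).
apply: eq_bigr => a _.
under eq_bigr => j _.
  rewrite (sum_antidiagonal (fun k l => g k ** h l) (ltn_ord j)).
  rewrite (bil_sumr mul_bil).
  under eq_bigr do rewrite (bil_sumr mul_bil) big_mkcond.
  over.
rewrite exchange_big; apply: eq_bigr => b _.
rewrite exchange_big [RHS]big_mkcond; apply: eq_bigr => c _.
rewrite -big_mkcondr.
case: eqP => [abc|abc].
  rewrite (eq_bigl (fun j : 'I_n.+1 => j == b + c :> nat)%N) => [|j]; last by lia.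
  by rewrite (big_ord1_eq _ (fun=> _)) ifT//; lia.
by rewrite big1// => j; lia.
Qed.

Lemma double_eq0 (x : A) : x = - x -> x = 0.
Proof.
move=> /eqP; rewrite -addr_eq0 -mulr2n -scaler_nat scaler_eq0 pnatr_eq0.
by move=> /eqP.
Qed.

(** The coefficient of [S^n] in [(f f) g - f (f g)] is the sum of
[asc (f a) (f b) (g c)] over [a + b + c = n].  Exchanging [a] and [b] changes the sign
of each term and permutes the index set, so this coefficient is its own opposite.  The
right alternative law follows in the same way from the last two arguments. *)
Lemma convolution_alternative : alternative_algebra convolution.
Proof.
have [_ altl altr] := mul_alt.
have swapl := asc_swapl mul_bil altl.
have swapr := asc_swapr mul_bil altr.
split=> [|f g|g f]; first exact: convolution_bilinear.
  apply/funext => n; apply/esym/eqP; rewrite -subr_eq0; apply/eqP/double_eq0.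
  rewrite convolution_left convolution_right -sumrB.
  under eq_bigr do (rewrite -sumrB; under eq_bigr do rewrite -sumrB).
  rewrite {1}exchange_big -sumrN; apply: eq_bigr => a _.
  rewrite -sumrN; apply: eq_bigr => b _.
  rewrite -sumrN; apply: eq_big => [c|c _]; first by rewrite (addnC a).
  exact: swapl.
apply/funext => n; apply/eqP; rewrite -subr_eq0; apply/eqP/double_eq0.
rewrite convolution_left convolution_right -sumrB.
under eq_bigr do (rewrite -sumrB; under eq_bigr do rewrite -sumrB big_mkcond).
rewrite -sumrN; apply: eq_bigr => a _.
rewrite {1}exchange_big -sumrN; apply: eq_bigr => b _.
rewrite -sumrN; apply: eq_bigr => c _.
rewrite addnAC; case: ifP => _; last by rewrite oppr0.
exact: swapr.
Qed.

End PowerSeries.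

(** The scalar variable [S] is central, so the two factors of the Cauchy product may be
reversed by [i |-> n - i]. *)
Lemma commutator_convolution (R : numFieldType) (A : lmodType R) (mul : A -> A -> A) f g :
  commutator (convolution mul) f g = convolution (commutator mul) f g.
Proof.
apply/funext => n; rewrite /commutator /convolution.
rewrite [LHS]/GRing.add/= [X in _ + X]/GRing.opp/=.
rewrite sumrB; congr (_ - _); rewrite (reindex_inj rev_ord_inj); apply: eq_bigr => i _ /=.
by rewrite subSS subKn// -ltnS.
Qed.

Definition monomial (A : nmodType) (x : A) (m : nat) : nat -> A :=
  fun n => if n == m then x else 0.

Lemma convolution_monomial (R : numFieldType) (A : lmodType R) (mul : A -> A -> A)
    x y m n :
  bilinear_map mul ->
  convolution mul (monomial x m) (monomial y n) = monomial (mul x y) (m + n).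
Proof.
move=> mul_bil; apply/funext => l; rewrite /convolution.
transitivity (\sum_(i < l.+1 | i == m :> nat) mul x (monomial y n (l - i)%N)).
  rewrite [RHS]big_mkcond; apply: eq_bigr => i _.
  by rewrite /monomial; case: eqP => // _; rewrite (bil0l mul_bil).
rewrite (big_ord1_eq +%R (fun i => mul x (monomial y n (l - i)%N))) /monomial.
case: ltnP => lm; last by rewrite ifF//; lia.
case: eqP => h; first by rewrite ifT//; lia.
by rewrite ifF ?(bil0r mul_bil)//; lia.
Qed.

(** * The split octonions *)

Section SplitOctonionAlgebra.
Variable R : realType.
Implicit Types (u v w : 'rV[R]_3) (x y z : octs R) (k : 'I_3).

(** The starting index [k] is free so that the components [k], [k + 1], [k + 2] of
vectors in a cross product and in a dot product are the same atoms for [ring]. *)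
Lemma dotmulE k u v :
  dotmul u v = u 0 k * v 0 k + u 0 (k + 1) * v 0 (k + 1) + u 0 (k + 2) * v 0 (k + 2).
Proof.
rewrite /dotmul (bigD1 k)// (bigD1 (k + 1)) /=; last by case: k => [[|[|[|k]]] ?].
rewrite (bigD1 (k + 2)) /=; last by case: k => [[|[|[|k]]] ?].
rewrite big1 ?addr0 ?addrA// => i.
by case: k i => [[|[|[|k]]] ?] [[|[|[|i]]] ?].
Qed.

Lemma ord3_add11 k : k + 1 + 1 = k + 2.
Proof. by rewrite -addrA. Qed.

Lemma ord3_add12 k : k + 1 + 2 = k.
Proof. by apply/val_inj; case: k => [[|[|[|k]]] ?]. Qed.

Lemma ord3_add21 k : k + 2 + 1 = k.
Proof. by apply/val_inj; case: k => [[|[|[|k]]] ?]. Qed.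

Lemma ord3_add22 k : k + 2 + 2 = k + 1.
Proof. by apply/val_inj; case: k => [[|[|[|k]]] ?]. Qed.

Let ord3E := (ord3_add11, ord3_add12, ord3_add21, ord3_add22).

Lemma octsP x y :
  octs_a x = octs_a y -> (forall k, octs_u x 0 k = octs_u y 0 k) ->
  (forall k, octs_v x 0 k = octs_v y 0 k) -> octs_b x = octs_b y -> x = y.
Proof.
case: x y => [[[a u] v] b] [[[a' u'] v'] b']; rewrite /octs_a /octs_u /octs_v /octs_b /=.
by move=> -> uu' vv' ->; congr (_, _, _, _); apply/rowP => k; rewrite ?uu' ?vv'.
Qed.

Lemma octs_aD x y : octs_a (x + y) = octs_a x + octs_a y. Proof. by []. Qed.
Lemma octs_bD x y : octs_b (x + y) = octs_b x + octs_b y. Proof. by []. Qed.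
Lemma octs_uD x y : octs_u (x + y) = octs_u x + octs_u y. Proof. by []. Qed.
Lemma octs_vD x y : octs_v (x + y) = octs_v x + octs_v y. Proof. by []. Qed.
Lemma octs_aZ c x : octs_a (c *: x) = c * octs_a x. Proof. by []. Qed.
Lemma octs_bZ c x : octs_b (c *: x) = c * octs_b x. Proof. by []. Qed.
Lemma octs_uZ c x : octs_u (c *: x) = c *: octs_u x. Proof. by []. Qed.
Lemma octs_vZ c x : octs_v (c *: x) = c *: octs_v x. Proof. by []. Qed.

Lemma octs_aN x : octs_a (- x) = - octs_a x. Proof. by []. Qed.
Lemma octs_bN x : octs_b (- x) = - octs_b x. Proof. by []. Qed.
Lemma octs_uN x : octs_u (- x) = - octs_u x. Proof. by []. Qed.
Lemma octs_vN x : octs_v (- x) = - octs_v x. Proof. by []. Qed.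

Lemma octs_aM x y :
  octs_a (octs_mul x y) = octs_a x * octs_a y + dotmul (octs_u x) (octs_v y).
Proof. by []. Qed.

Lemma octs_uM x y : octs_u (octs_mul x y) =
  octs_a x *: octs_u y + octs_b y *: octs_u x - crossmul (octs_v x) (octs_v y).
Proof. by []. Qed.

Lemma octs_vM x y : octs_v (octs_mul x y) =
  octs_a y *: octs_v x + octs_b x *: octs_v y + crossmul (octs_u x) (octs_u y).
Proof. by []. Qed.

Lemma octs_bM x y :
  octs_b (octs_mul x y) = octs_b x * octs_b y + dotmul (octs_v x) (octs_u y).
Proof. by []. Qed.

Let octsE := (octs_aD, octs_bD, octs_uD, octs_vD, octs_aZ, octs_bZ, octs_uZ,
  octs_vZ, octs_aN, octs_bN, octs_uN, octs_vN, octs_aM, octs_uM, octs_vM, octs_bM).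

Lemma octs_mul_bilinear : bilinear_map (@octs_mul R).
Proof.
by split=> [y c x x'|x c y y']; cbv beta; apply: octsP => [|k|k|];
  rewrite !octsE ?(dotmulE 0) ?(dotmulE 0) ?(dotmulE 0) !mxE; ring.
Qed.

(** Componentwise polynomial identities in the sixteen coordinates. *)
Lemma octs_alternative : alternative_algebra (@octs_mul R).
Proof.
split=> [|x y|x y]; first exact: octs_mul_bilinear.
  by apply: octsP => [|k|k|]; rewrite !octsE;
    first [rewrite !(dotmulE k)|rewrite !(dotmulE 0)];
    rewrite !mxE ?ord3E; ring.
by apply: octsP => [|k|k|]; rewrite !octsE;
    first [rewrite !(dotmulE k)|rewrite !(dotmulE 0)];
    rewrite !mxE ?ord3E; ring.
Qed.

Lemma mem_Im_octs x : (x \in Im_octs R) = (octs_trace x == 0).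
Proof. by rewrite memv_ker lfunE. Qed.

(** The trace of a product is symmetric. *)
Lemma commutator_Im x y : commutator (@octs_mul R) x y \in Im_octs R.
Proof.
rewrite mem_Im_octs /commutator linearB subr_eq0; apply/eqP.
change (octs_a (octs_mul x y) + octs_b (octs_mul x y) =
        octs_a (octs_mul y x) + octs_b (octs_mul y x)).
by rewrite !octsE !(dotmulE 0); ring.
Qed.

Let octs_of_u u : octs R := Defs.Zorn 0 u 0 0.
Let octs_of_v v : octs R := Defs.Zorn 0 0 v 0.

Lemma octs_commutator_u u w :
  commutator (@octs_mul R) (octs_of_u u) (octs_of_u w) =
  octs_of_v (crossmul u w - crossmul w u).
Proof.
apply: octsP => [|k|k|]; rewrite /commutator !octsE ?(dotmulE 0) /octs_of_u /octs_of_v;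
  by rewrite /octs_a /octs_u /octs_v /octs_b /= !mxE; ring.
Qed.

Lemma octs_commutator_vu v u :
  octs_b (commutator (@octs_mul R) (octs_of_v v) (octs_of_u u)) = dotmul v u.
Proof.
rewrite /commutator !octsE !(dotmulE 0) /octs_of_u /octs_of_v.
by rewrite /octs_a /octs_u /octs_v /octs_b /= !mxE; ring.
Qed.

(** The witnesses are the unit vectors [u_0, u_1, u_2].  Each double commutator
[[u_i, u_(i + 1)], u_(i + 2)] has the lower diagonal entry [2], since
[[u_i, u_(i + 1)]] is twice the unit vector [v_(i + 2)], so the entry of the Jacobiator
is [6]. *)
Lemma jacobiator_Im_neq0 : exists x y z,
  [/\ x \in Im_octs R, y \in Im_octs R, z \in Im_octs R &
      jacobiator (@octs_mul R) x y z != 0].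
Proof.
have uIm u : octs_of_u u \in Im_octs R by rewrite mem_Im_octs /octs_trace addr0.
exists (octs_of_u (delta_mx 0 0)), (octs_of_u (delta_mx 0 1)), (octs_of_u (delta_mx 0 2)).
split=> //; rewrite /jacobiator !octs_commutator_u.
apply/eqP => /(congr1 (@octs_b R)); rewrite 2!octs_bD !octs_commutator_vu.
rewrite !(dotmulE 0) !mxE /=; lra.
Qed.

End SplitOctonionAlgebra.

(** * Truncated norms *)

Section TruncatedNorms.
Variables (R : realType) (alpha : R) (alpha_gt1 : 1 < alpha).
Local Notation wl1 := (wl1 alpha_gt1).
Implicit Types (a b : 'I_7 * nat -> R^o) (X Y : wl1).

Definition layer_norm a (n : nat) : R := \sum_(k < 7) `|a (k, n)|.

(** All estimates of the norm go through these finite sums: the norm is their supremum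
by [truncated_norm_le] and [norm_le_truncated]. *)
Definition truncated_norm a (N : nat) : R :=
  \sum_(n < N) layer_norm a n * alpha ^+ n.

Lemma weight_ge1 n : 1 <= alpha ^+ n.
Proof. by rewrite exprn_ege1// ltW. Qed.

Lemma weight_ge0 n : 0 <= alpha ^+ n.
Proof. by rewrite (le_trans ler01)// weight_ge1. Qed.

Lemma layer_norm_ge0 a n : 0 <= layer_norm a n.
Proof. exact: sumr_ge0. Qed.

Let box N : seq ('I_7 * nat) :=
  [seq (k, n) | k <- index_enum 'I_7, n <- iota 0 N].

Let mem_box N p : (p \in box N) = (p.2 < N)%N.
Proof.
apply/allpairsP/idP => [[[k n] /= [_ + ->]]|pN]; first by rewrite mem_iota.
by exists p; rewrite mem_index_enum mem_iota; case: p pN.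
Qed.

Let term_ge0 a (p : 'I_7 * nat) : (0 <= (`|a p| * alpha ^+ p.2)%:E)%E.
Proof. by rewrite lee_fin mulr_ge0// weight_ge0. Qed.

Let fsum_box a N :
  (\sum_(p \in [set` box N]) (`|a p| * alpha ^+ p.2)%:E)%E = (truncated_norm a N)%:E.
Proof.
rewrite -fsbig_seq; last first.
  by rewrite allpairs_uniq ?index_enum_uniq ?iota_uniq// => -[? ?] [? ?].
rewrite sumEFin big_allpairs exchange_big -{1}(subn0 N) -/(index_iota 0 N) big_mkord.
by congr EFin; apply: eq_bigr => n _; rewrite /layer_norm mulr_suml.
Qed.

Lemma truncated_norm_le_enorm a N :
  ((truncated_norm a N)%:E <= wl1_enorm alpha a)%E.
Proof.
apply: esum_ge; exists [set` box N]; last by rewrite fsum_box.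
by split=> //; exact: finite_seq.
Qed.

(** A finite set of indices lies in a box [k < 7, n < N]. *)
Lemma enorm_le_truncated a M :
  (forall N, truncated_norm a N <= M) -> (wl1_enorm alpha a <= M%:E)%E.
Proof.
move=> aM; apply: ge_ereal_sup => _ [A [/[dup] finA /finite_seqP[s As] _] <-].
pose N := (\max_(p <- s) p.2).+1.
rewrite (@le_trans _ _ (truncated_norm a N)%:E) ?lee_fin// -fsum_box.
apply: lee_fsum_nneg_subset => [//||p|p _]; [exact: finite_seq| |exact: term_ge0].
rewrite As => /set_mem /= ps; apply/mem_set => /=.
by rewrite mem_box ltnS; exact: (leq_bigmax_seq p ps).
Qed.

Lemma wl1_predP a M : (forall N, truncated_norm a N <= M) -> a \in wl1_pred alpha_gt1.
Proof.
by move=> /enorm_le_truncated aM; rewrite unfold_in (le_lt_trans aM)// ltry.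
Qed.

Lemma truncated_norm_le X N : truncated_norm (coef X) N <= `|X|.
Proof. by rewrite -lee_fin [(`|X|)%:E]wl1_normE truncated_norm_le_enorm. Qed.

Lemma norm_le_truncated X M : (forall N, truncated_norm (coef X) N <= M) -> `|X| <= M.
Proof. by move=> XM; rewrite -lee_fin [(`|X|)%:E]wl1_normE enorm_le_truncated. Qed.

Lemma norm_gen i n : `|gen alpha_gt1 i n| = alpha ^+ n.
Proof. by apply: EFin_inj; rewrite [LHS]wl1_normE wl1_enorm_delta. Qed.

Lemma wl1_coefB X Y p : coef (X - Y) p = coef X p - coef Y p.
Proof. by []. Qed.

Lemma wl1_coefZ c X p : coef (c *: X) p = c * coef X p.
Proof. by []. Qed.

Lemma wl1_coef_sum I r (P : pred I) (F : I -> wl1) p :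
  coef (\sum_(i <- r | P i) F i) p = \sum_(i <- r | P i) coef (F i) p.
Proof. by elim/big_ind2: _ => // ? ? ? ? <- <-. Qed.

(** The weights are at least 1, so the coefficients are 1-Lipschitz. *)
Lemma coef_le_norm X p : `|coef X p| <= `|X|.
Proof.
case: p => k n; apply: le_trans (truncated_norm_le X n.+1).
rewrite /truncated_norm big_ord_recr/= /layer_norm (bigD1 k)//=.
rewrite mulrDl ler_wpDl ?sumr_ge0// => [m _|].
  by rewrite mulr_ge0 ?layer_norm_ge0 ?weight_ge0.
by rewrite ler_wpDr ?mulr_ge0 ?weight_ge0 ?sumr_ge0// ler_peMr// weight_ge1.
Qed.

(** * Completeness and density of the generators *)

(** The image of the filter under each coefficient map is Cauchy; let [c] be the family
of limits in the reals.
If [X] is a centre of a ball of radius [eps] of the filter, the truncated norms of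
[X - Y] are at most [eps] for [Y] in this ball, and passing to the limit in [Y] bounds
the truncated norms of [X - c] by [eps].  Hence [c] lies in the space and is the limit. *)
Lemma wl1_complete : complete_space wl1.
Proof.
move=> F FF Fcauchy.
have Fball : cauchy_ex F by apply/cauchyP.
have coef_cvg p : cvg (coef X p @[X --> F]).
  apply: cauchy_cvg; apply: cauchy_exP => eps eps0.
  have [X FX] := Fball _ eps0; exists (coef X p).
  suff : F [set Y | ball (coef X p : R^o) eps (coef Y p)] by [].
  apply: filterS FX => Y; rewrite -!ball_normE /= => XY.
  by rewrite (le_lt_trans _ XY)// -wl1_coefB coef_le_norm.
pose c : 'I_7 * nat -> R^o := fun p => lim (coef X p @[X --> F]).
have trunc_le X eps N : F (ball X eps) -> truncated_norm (coef X - c) N <= eps.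
  move=> FX; have trunc_cvg : (truncated_norm (coef (X - Y)) N : R) @[Y --> F]
      --> (truncated_norm (coef X - c) N : R).
    apply: cvg_big => [|n _]; first exact: add_continuous.
    apply: cvgM; last exact: cvg_cst.
    apply: cvg_big => [|k _]; first exact: add_continuous.
    by apply: cvg_norm; apply: cvgB; [exact: cvg_cst|exact: coef_cvg].
  apply: (cvgr_to_le trunc_cvg).
  apply: filterS FX => Y; rewrite -ball_normE /= => /ltW; apply: le_trans.
  exact: (truncated_norm_le (X - Y) N).
have c_wl1 : c \in wl1_pred alpha_gt1.
  have [X FX] := Fball _ ltr01.
  have -> : c = coef X - (coef X - c) by rewrite opprB addrC subrK.
  by rewrite rpredB ?coef_wl1// (wl1_predP (M := 1))// => N; exact: trunc_le.
apply/cvg_ex; exists (Wl1 c_wl1); apply/cvgrPdist_lt => eps eps0.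
have eps20 : 0 < eps / 2 by rewrite divr_gt0.
have [X FX] := Fball _ eps20.
apply: filterS (FX) => Y; rewrite -ball_normE /= => XY.
have cX : `|X - Wl1 c_wl1| <= eps / 2.
  by apply: norm_le_truncated => N; exact: trunc_le.
rewrite (splitr eps) -(subrK X (Wl1 _)) -addrA.
by rewrite (le_lt_trans (ler_normD _ _))// ler_ltD// distrC.
Qed.

Definition wl1_truncation X N : wl1 :=
  \sum_(n < N) \sum_(k < 7) coef X (k, n : nat) *: gen alpha_gt1 k n.

Lemma coef_truncation X N k n :
  coef (wl1_truncation X N) (k, n) = if (n < N)%N then coef X (k, n) else 0.
Proof.
rewrite wl1_coef_sum -[RHS](big_ord1_eq +%R (fun m => coef X (k, m))).
rewrite [RHS]big_mkcond; apply: eq_bigr => m _.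
rewrite wl1_coef_sum (bigD1 k)// big1 ?addr0 => [|j jk]; rewrite wl1_coefZ /=.
  by rewrite addr0 xpair_eqE eqxx /= eq_sym; case: eqP => _; rewrite (mulr1, mulr0). 
by rewrite xpair_eqE eq_sym (negbTE jk) mulr0.
Qed.

(** Truncation leaves the tail: the norm of [X - wl1_truncation X N] plus the truncated
norm of [X] at [N] is at most the norm of [X]. *)
Lemma truncation_dense X eps : 0 < eps -> exists N, `|X - wl1_truncation X N| <= eps.
Proof.
move=> eps0.
have [N XN] : exists N, `|X| - eps < truncated_norm (coef X) N.
  apply/not_existsP => XN; suff : `|X| <= `|X| - eps by rewrite lerBrDl gerDr leNgt eps0.
  by apply: norm_le_truncated => N; rewrite leNgt; exact/negP.
exists N; apply: norm_le_truncated => M.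
rewrite -(lerD2r (truncated_norm (coef X) N)).
apply: (@le_trans _ _ `|X|); last by move: XN; lra.
apply: le_trans (truncated_norm_le X (M + N)).
(* [M + N] is a common upper bound for the two truncation orders. *)
have truncE a K : (K <= M + N)%N -> truncated_norm a K =
    \sum_(n < M + N) (if (n < K)%N then layer_norm a n * alpha ^+ n else 0).
  move=> KMN; rewrite /truncated_norm -big_mkcond.
  by rewrite (big_ord_widen _ (fun n => layer_norm a n * alpha ^+ n) KMN).
rewrite !truncE ?leq_addr ?leq_addl// -big_split; apply: ler_sum => n _ /=.
have layer_diff : layer_norm (coef (X - wl1_truncation X N)) n =
    if (n < N)%N then 0 else layer_norm (coef X) n.
  rewrite /layer_norm; case: ifPn => nN.
    by apply: big1 => k _; rewrite wl1_coefB coef_truncation nN subrr normr0.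
  by apply: eq_bigr => k _; rewrite wl1_coefB coef_truncation (negbTE nN) subr0.
rewrite layer_diff ltn_ord; case: (n < N)%N; case: (n < M)%N;
  by rewrite ?mul0r ?add0r ?addr0// mulr_ge0 ?layer_norm_ge0 ?weight_ge0.
Qed.

(** A linear map that kills the generators kills every truncation, hence
[h X = h (X - wl1_truncation X N)], which is small by continuity at [0]. *)
Lemma linear_continuous_gen (h : wl1 -> wl1) : linear h -> continuous h ->
  (forall i n, h (gen alpha_gt1 i n) = 0) -> forall X, h X = 0.
Proof.
move=> h_lin h_cont h_gen X.
pose H : {linear wl1 -> wl1} := HB.pack h (GRing.isLinear.Build R wl1 wl1 *:%R h h_lin).
have h0 : h 0 = 0 by exact: (linear0 H).
have h_trunc N : h (wl1_truncation X N) = 0.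
  rewrite -[LHS]/(H _) linear_sum big1// => n _; rewrite linear_sum big1// => k _.
  by rewrite linearZ /= h_gen scaler0.
have hB N : h (X - wl1_truncation X N) = h X.
  by rewrite -[LHS]/(H _) linearB /= h_trunc subr0.
apply/eqP; rewrite -normr_le0; apply/ler_addgt0Pr => eps eps0; rewrite add0r.
have : \forall Y \near (0 : wl1), `|h 0 - h Y| < eps.
  by move/cvgrPdist_lt : (h_cont 0); exact.
rewrite h0 => /nbhs_ballP[d /= d0 dh].
have [N XN] := truncation_dense X (divr_gt0 d0 (ltr0n _ 2)).
rewrite -(hB N) -normrN -[- h _]add0r ltW//; apply: dh.
rewrite -ball_normE /= sub0r normrN (le_lt_trans XN)//.
by rewrite ltr_pdivrMr// ltr_pMr// ltr1n.
Qed.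

End TruncatedNorms.

(** * Brackets on normed spaces *)

Lemma malcev_algebra_inj (R : pzRingType) (V A : lmodType R) (brV : V -> V -> V)
    (brA : A -> A -> A) (f : {linear V -> A}) :
  injective f -> (forall x y, f (brV x y) = brA (f x) (f y)) ->
  malcev_algebra brA -> malcev_algebra brV.
Proof.
move=> f_inj fM [A_bil A_anti A_malcev]; split=> [|x y|x y z].
- split=> [y c x x'|x c y y']; apply: f_inj; rewrite !(fM, linearP).
    by rewrite (bilDl A_bil) (bilZl A_bil).
  by rewrite (bilDr A_bil) (bilZr A_bil).
- by apply: f_inj; rewrite linearN !fM.
- by apply: f_inj; rewrite !linearD !fM.
Qed.

(** [br x y - br x0 y0 = br (x - x0) y + br x0 (y - y0)], whose norm is at most an
explicit continuous function that vanishes at [(x0, y0)]. *)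
Lemma bounded_bilinear_continuous (R : realType) (V : normedModType R)
    (br : V -> V -> V) (C : R) : bilinear_map br ->
  (forall x y, `|br x y| <= C * `|x| * `|y|) -> continuous_bracket br.
Proof.
move=> br_bil brC [x0 y0].
pose bound (p : V * V) : R := C * `|p.1 - x0| * `|p.2| + C * `|x0| * `|p.2 - y0|.
have bound_cvg : bound p @[p --> (x0, y0)] --> (0 : R).
  have -> : (0 : R) = C * `|x0 - x0| * `|y0| + C * `|x0| * `|y0 - y0|.
    by rewrite !subrr normr0 !mulr0 mul0r addr0.
  apply: cvgD.
    apply: cvgM; last by apply: cvg_norm; exact: cvg_snd.
    apply: cvgM; first exact: cvg_cst.
    by apply: cvg_norm; apply: cvgB; [exact: cvg_fst|exact: cvg_cst].
  apply: cvgM; first exact: cvg_cst.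
  by apply: cvg_norm; apply: cvgB; [exact: cvg_snd|exact: cvg_cst].
apply/cvgrPdist_lt => eps eps0.
move/cvgrPdist_lt : bound_cvg => /(_ eps eps0); apply: filterS => -[x y] /=.
rewrite sub0r normrN => /(le_lt_trans (ler_norm _)); apply: le_lt_trans.
rewrite distrC.
have -> : br x y - br x0 y0 = br (x - x0) y + br x0 (y - y0).
  by rewrite (bilBl br_bil) (bilBr br_bil) addrA subrK.
by rewrite (le_trans (ler_normD _ _))// lerD.
Qed.

(** With [continuous_bracket_subl], the separate continuity used to compare two brackets
on generators. *)
Lemma continuous_bracket_subr (R : numFieldType) (V : normedModType R)
    (br br' : V -> V -> V) x :
  continuous_bracket br -> continuous_bracket br' ->
  continuous (fun y => br x y - br' x y).
Proof.
move=> br_cont br'_cont y; apply: cvgB.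
  apply: (@continuous2_cvg _ _ _ _ _ _ (fun=> x) id br x y (br_cont (x, y))).
    exact: cvg_cst.
  exact: cvg_id.
apply: (@continuous2_cvg _ _ _ _ _ _ (fun=> x) id br' x y (br'_cont (x, y))).
  exact: cvg_cst.
exact: cvg_id.
Qed.

Lemma continuous_bracket_subl (R : numFieldType) (V : normedModType R)
    (br br' : V -> V -> V) y :
  continuous_bracket br -> continuous_bracket br' ->
  continuous (fun x => br x y - br' x y).
Proof.
move=> br_cont br'_cont x; apply: cvgB.
  apply: (@continuous2_cvg _ _ _ _ _ _ id (fun=> y) br x y (br_cont (x, y))).
    exact: cvg_id.
  exact: cvg_cst.
apply: (@continuous2_cvg _ _ _ _ _ _ id (fun=> y) br' x y (br'_cont (x, y))).
  exact: cvg_id.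
exact: cvg_cst.
Qed.

(** * The octonion bracket on the weighted space *)

Section ShiftBracket.
Variables (R : realType) (alpha : R) (alpha_gt1 : 1 < alpha).
Variables (e : 7.-tuple (octs R)) (he : standard_basis e).
Local Notation wl1 := (wl1 alpha_gt1).
Local Notation com := (commutator (@octs_mul R)).

Let e_basis : basis_of (Im_octs R) e. Proof. by case: he. Qed.
Let e_free : free e. Proof. exact: basis_free e_basis. Qed.
Let mul_bil := octs_mul_bilinear R.
Let com_bil : bilinear_map com. Proof. exact: commutator_bilinear. Qed.

(** For [i != j] the basis vectors anticommute, so the commutator is twice
[e_i e_j = +- e_k]. *)
Lemma standard_basis_commutator (i j : 'I_7) :
  exists (k : 'I_7) (s : R),
    com e`_i e`_j = s *: e`_k /\ `|s| = if i == j then 0 else 2.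
Proof.
have [_ _ [L _ eL]] := he.
case: eqP => [->|/eqP ij]; first by exists j, 0; rewrite /commutator subrr scale0r normr0.
have [k [_ anti eij]] := eL i j ij; exists k.
have -> : com e`_i e`_j = 2 *: octs_mul e`_i e`_j.
  by rewrite /commutator scaler_nat mulr2n (canRL opprK (esym anti)) opprK.
case: eij => ->; first by exists 2; rewrite normr_nat.
by exists (- 2); rewrite scalerN scaleNr normrN normr_nat.
Qed.

(** The embedding of the weighted space into formal power series over the octonions,
which makes it special. *)
Definition octonion_series (X : wl1) : nat -> octs R :=
  fun n => \sum_(k < 7) coef X (k, n) *: e`_k.

Lemma octonion_series_is_linear : linear octonion_series.
Proof.
move=> c X Y; apply/funext => n; rewrite /octonion_series.
rewrite [RHS]/GRing.add/= [(c *: _) n]/GRing.scale/= scaler_sumr -big_split.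
by apply: eq_bigr => k _ /=; rewrite scalerA -scalerDl.
Qed.

HB.instance Definition _ := GRing.isLinear.Build R wl1 (nat -> octs R) *:%R
  octonion_series octonion_series_is_linear.

Lemma coord_octonion_series X k n : coord e k (octonion_series X n) = coef X (k, n).
Proof. by rewrite (coord_sum_free (fun k => coef X (k, n))). Qed.

Lemma octonion_series_inj : injective octonion_series.
Proof.
move=> X Y XY; apply/val_inj/funext => -[k n] /=.
by rewrite -!coord_octonion_series XY.
Qed.

Lemma octonion_series_shift z n :
  z \in Im_octs R -> octonion_series (oct_shift alpha_gt1 e z n) = monomial z n.
Proof.
move=> zIm; apply/funext => l; rewrite /octonion_series /monomial.
have coefE k : coef (oct_shift alpha_gt1 e z n) (k, l) =
    if l == n then coord e k z else 0.
  rewrite wl1_coef_sum (bigD1 k)// big1 ?addr0 => [|j jk]; rewrite wl1_coefZ /= xpair_eqE.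
    by rewrite eqxx; case: eqP => _; rewrite (mulr1, mulr0) addr0.
  by rewrite eq_sym (negbTE jk) mulr0.
under eq_bigr do rewrite coefE.
case: eqP => _; first by rewrite -(coord_basis e_basis zIm).
by rewrite big1// => k _; rewrite scale0r.
Qed.

Lemma oct_shift_basis s (k : 'I_7) n :
  oct_shift alpha_gt1 e (s *: e`_k) n = s *: gen alpha_gt1 k n.
Proof.
rewrite /oct_shift (bigD1 k)// big1 ?addr0 => [|j jk]; rewrite linearZ /= coord_free//.
  by rewrite eqxx mulr1 addr0.
by rewrite eq_sym (negbTE jk) mulr0 scale0r.
Qed.

Lemma mem_standard_basis (k : 'I_7) : e`_k \in Im_octs R.
Proof. by rewrite (basis_mem e_basis)// mem_nth// size_tuple. Qed.

Definition coord_norm (z : octs R) : R := \sum_(k < 7) `|coord e k z|.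

Lemma coord_norm_sum I r (P : pred I) (F : I -> octs R) :
  coord_norm (\sum_(i <- r | P i) F i) <= \sum_(i <- r | P i) coord_norm (F i).
Proof.
rewrite /coord_norm exchange_big; apply: ler_sum => k _.
by rewrite linear_sum ler_norm_sum.
Qed.

Lemma coord_normZ c z : coord_norm (c *: z) = `|c| * coord_norm z.
Proof.
by rewrite /coord_norm mulr_sumr; apply: eq_bigr => k _; rewrite linearZ normrM.
Qed.

Lemma coord_norm_basis (k : 'I_7) : coord_norm e`_k = 1.
Proof.
rewrite /coord_norm (bigD1 k)// big1 => [|j jk]; rewrite coord_free//.
  by rewrite /= eqxx normr1 addr0.
by rewrite eq_sym (negbTE jk) normr0.
Qed.

Lemma coord_norm_commutator (f g : 'I_7 -> R) :
  coord_norm (com (\sum_(i < 7) f i *: e`_i) (\sum_(j < 7) g j *: e`_j)) <=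
  2 * (\sum_(i < 7) `|f i|) * \sum_(j < 7) `|g j|.
Proof.
rewrite (bil_suml com_bil) (le_trans (coord_norm_sum _ _ _))// -mulrA mulr_suml mulr_sumr.
apply: ler_sum => i _; rewrite (bil_sumr com_bil) (le_trans (coord_norm_sum _ _ _))//.
rewrite !mulr_sumr; apply: ler_sum => j _.
rewrite (bilZl com_bil) (bilZr com_bil) !coord_normZ.
have [k [s [-> s2]]] := standard_basis_commutator i j.
rewrite coord_normZ coord_norm_basis mulr1 mulrA mulrC ler_wpM2r//.
by rewrite s2; case: ifP.
Qed.

(** Convolving by the commutator is the same as taking the commutator of the Cauchy
product, by [commutator_convolution]; this form is the one that can be estimated. *)
Definition shift_bracket_coef (X Y : wl1) (p : 'I_7 * nat) : R^o :=
  coord e p.1 (convolution com (octonion_series X) (octonion_series Y) p.2).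

Lemma layer_norm_shift_bracket X Y n :
  layer_norm (shift_bracket_coef X Y) n <=
  \sum_(i < n.+1) 2 * layer_norm (coef X) i * layer_norm (coef Y) (n - i)%N.
Proof.
rewrite -[layer_norm _ _]/(coord_norm (convolution _ _ _ _)).
rewrite (le_trans (coord_norm_sum _ _ _))//; apply: ler_sum => i _.
exact: coord_norm_commutator.
Qed.

(** The weight of [S^n] splits as [alpha ^ i * alpha ^ (n - i)] along the convolution, so
[sum_convolution_le] applies to the weighted layers of [X] and [Y]. *)
Lemma truncated_norm_shift_bracket X Y N :
  truncated_norm alpha (shift_bracket_coef X Y) N <= 2 * `|X| * `|Y|.
Proof.
pose u n := 2 * (layer_norm (coef X) n * alpha ^+ n).
pose v n := layer_norm (coef Y) n * alpha ^+ n.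
have v0 n : 0 <= v n by rewrite mulr_ge0 ?layer_norm_ge0 ?(weight_ge0 alpha_gt1).
have u0 n : 0 <= u n.
  by rewrite !mulr_ge0 ?layer_norm_ge0 ?(weight_ge0 alpha_gt1).
apply: (@le_trans _ _ (\sum_(n < N) \sum_(i < n.+1) u i * v (n - i)%N)).
  apply: ler_sum => n _.
  apply: le_trans (ler_wpM2r (weight_ge0 alpha_gt1 n) (layer_norm_shift_bracket X Y n)) _.
  rewrite mulr_suml; apply: ler_sum => i _; rewrite /u /v.
  have -> : alpha ^+ n = alpha ^+ i * alpha ^+ (n - i) by rewrite -exprD subnKC// -ltnS.
  by rewrite le_eqVlt; apply/orP; left; apply/eqP; ring.
rewrite (le_trans (sum_convolution_le N u0 v0))// -mulr_sumr.
have trunc0 Z : 0 <= truncated_norm alpha (coef Z) N.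
  by apply: sumr_ge0 => n _; rewrite mulr_ge0 ?layer_norm_ge0 ?(weight_ge0 alpha_gt1).
rewrite -[leLHS]/(2 * truncated_norm alpha (coef X) N * truncated_norm alpha (coef Y) N).
by rewrite ler_pM ?mulr_ge0 ?ler_wpM2l ?truncated_norm_le.
Qed.

Lemma shift_bracket_coef_wl1 X Y : shift_bracket_coef X Y \in wl1_pred alpha_gt1.
Proof. exact: wl1_predP (truncated_norm_shift_bracket X Y). Qed.

Definition octonion_bracket X Y : wl1 := Wl1 (shift_bracket_coef_wl1 X Y).
Local Notation br := octonion_bracket.

Lemma octonion_bracket_le X Y : `|br X Y| <= 2 * `|X| * `|Y|.
Proof. by apply: norm_le_truncated => N; exact: truncated_norm_shift_bracket. Qed.

(** The coordinates of the commutator determine it because it is traceless, hence in the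
span of [e]. *)
Lemma octonion_series_bracket X Y :
  octonion_series (br X Y) =
  commutator (convolution (@octs_mul R)) (octonion_series X) (octonion_series Y).
Proof.
rewrite commutator_convolution; apply/funext => n; rewrite [LHS]/octonion_series.
rewrite [RHS](coord_basis e_basis)// /convolution memv_suml// => i _.
exact: commutator_Im.
Qed.

Lemma convolution_octs_alternative : alternative_algebra (convolution (@octs_mul R)).
Proof. exact: convolution_alternative (octs_alternative R). Qed.

Lemma octonion_bracket_malcev : malcev_algebra br.
Proof.
have [conv_bil altl altr] := convolution_octs_alternative.
apply: (malcev_algebra_inj (f := octonion_series)); first exact: octonion_series_inj.
  exact: octonion_series_bracket.
exact: commutator_malcev.
Qed.

Lemma octonion_bracket_special : special br.
Proof.
exists (nat -> octs R), (convolution (@octs_mul R)), octonion_series; split.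
- exact: convolution_octs_alternative.
- exact: octonion_series_inj.
- exact: octonion_series_bracket.
Qed.

(** In particular [z |-> z S^0] is a morphism from the imaginary octonions with the
commutator. *)
Lemma octonion_bracket_shift x y m n : x \in Im_octs R -> y \in Im_octs R ->
  br (oct_shift alpha_gt1 e x m) (oct_shift alpha_gt1 e y n) =
  oct_shift alpha_gt1 e (com x y) (m + n).
Proof.
move=> xIm yIm; apply: octonion_series_inj.
rewrite octonion_series_bracket commutator_convolution !octonion_series_shift//.
  exact: convolution_monomial.
exact: commutator_Im.
Qed.

Lemma oct_shift_gen (k : 'I_7) n : oct_shift alpha_gt1 e e`_k n = gen alpha_gt1 k n.
Proof. by rewrite -[e`_k]scale1r oct_shift_basis scale1r. Qed.

Lemma octonion_bracket_shift_bracket : shift_bracket e br.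
Proof.
have [br_bil _ _] := octonion_bracket_malcev; split=> // [|i j m n].
  exact: bounded_bilinear_continuous br_bil octonion_bracket_le.
by rewrite -!oct_shift_gen octonion_bracket_shift ?mem_standard_basis.
Qed.

(** The Jacobi identity on the elements [z S^0] would give it for the commutator of
imaginary octonions. *)
Lemma octonion_bracket_not_lie : ~ lie_algebra br.
Proof.
move=> [_ _ jacobi].
have [x [y [z [xIm yIm zIm /negP]]]] := jacobiator_Im_neq0 R; apply.
have := jacobi (oct_shift _ e x 0) (oct_shift _ e y 0) (oct_shift _ e z 0).
rewrite !octonion_bracket_shift ?commutator_Im// !addn0.
move/(congr1 octonion_series).
rewrite linear0 2!linearD /= !octonion_series_shift ?commutator_Im//.
move/(congr1 (fun f => f 0%N)) => jac; apply/eqP.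
transitivity (- (com x (com y z) + com y (com z x) + com z (com x y))).
  rewrite /jacobiator (commutatorC _ (com x y) z) (commutatorC _ (com y z) x).
  by rewrite (commutatorC _ (com z x) y) -!opprD -addrA [in LHS]addrC.
by rewrite [X in - X]jac oppr0.
Qed.

(** Two applications of [linear_continuous_gen] to the difference of the brackets, first
in the second argument with a generator in the first, then in the first argument. *)
Lemma shift_bracket_unique br' : shift_bracket e br' -> br' = br.
Proof.
have [br_bil br_cont br_gen] := octonion_bracket_shift_bracket.
move=> [br'_bil br'_cont br'_gen].
have eqr i m Y : br' (gen alpha_gt1 i m) Y = br (gen alpha_gt1 i m) Y.
  apply/eqP; rewrite -subr_eq0; apply/eqP; move: Y.
  apply: linear_continuous_gen => [c Y Y'||j n].
  - rewrite (bilDr br_bil) (bilZr br_bil) (bilDr br'_bil) (bilZr br'_bil).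
    by rewrite opprD addrACA scalerBr.
  - exact: continuous_bracket_subr br'_cont br_cont.
  - by rewrite br_gen br'_gen subrr.
apply/funext => X; apply/funext => Y.
apply/eqP; rewrite -subr_eq0; apply/eqP; move: X.
apply: linear_continuous_gen => [c X X'||i m].
- rewrite (bilDl br_bil) (bilZl br_bil) (bilDl br'_bil) (bilZl br'_bil).
  by rewrite opprD addrACA scalerBr.
- exact: continuous_bracket_subl br'_cont br_cont.
- by rewrite eqr subrr.
Qed.

Lemma norm_octonion_bracket_gen i j m n :
  `|br (gen alpha_gt1 i m) (gen alpha_gt1 j n)| =
  (if i == j then 0 else 2) * (`|gen alpha_gt1 i m| * `|gen alpha_gt1 j n|).
Proof.
have [_ _ ->] := octonion_bracket_shift_bracket.
have [k [s [es <-]]] := standard_basis_commutator i j.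
by rewrite -/(commutator _ _ _) es oct_shift_basis normrZ !norm_gen exprD.
Qed.

(** The quotients in the supremum are [0] for equal basis vectors and [2] otherwise. *)
Lemma bracket_constant_octonion : bracket_constant br = 2.
Proof.
have ratio i m j n : `|br (gen alpha_gt1 i m) (gen alpha_gt1 j n)| /
    (`|gen alpha_gt1 i m| * `|gen alpha_gt1 j n|) = if i == j then 0 else 2.
  rewrite norm_octonion_bracket_gen mulfK// !norm_gen mulf_neq0//.
    by rewrite gt_eqF// (lt_le_trans ltr01) ?(weight_ge1 alpha_gt1).
  by rewrite gt_eqF// (lt_le_trans ltr01) ?(weight_ge1 alpha_gt1).
have ub2 : ubound [set r | exists i m j n,
    r = `|br (gen alpha_gt1 i m) (gen alpha_gt1 j n)| /
        (`|gen alpha_gt1 i m| * `|gen alpha_gt1 j n|)] 2.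
  by move=> _ [i [m [j [n ->]]]]; rewrite ratio; case: ifP.
have mem2 : exists i m j n,
    2 = `|br (gen alpha_gt1 i m) (gen alpha_gt1 j n)| /
        (`|gen alpha_gt1 i m| * `|gen alpha_gt1 j n|).
  by exists ord0, 0, ord_max, 0; rewrite ratio.
apply/eqP; rewrite eq_le; apply/andP; split.
  by apply: ge_sup => //; exists 2.
by apply: ub_le_sup => //; exists 2.
Qed.

End ShiftBracket.

Theorem mainTheorem2 (R : realType) (alpha : R) (alpha_gt1 : 1 < alpha)
    (e : 7.-tuple (octs R)) (he : standard_basis e) :
  exists br : wl1 alpha_gt1 -> wl1 alpha_gt1 -> wl1 alpha_gt1,
    [/\ shift_bracket e br /\ (forall br', shift_bracket e br' -> br' = br),
        banach_malcev_algebra br /\ special br,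
        ~ lie_algebra br,
        bracket_constant br = 2
          /\ (forall X Y, `|br X Y| <= bracket_constant br * `|X| * `|Y|) &
        forall (c : tree -> rat) (K : R),
          bch_coefficients c -> 1 <= K -> (forall t, `|ratr (c t)| <= K) ->
          bch_radius K (bracket_constant br) = (8 * K)^-1].
Proof.
have br_shift := octonion_bracket_shift_bracket alpha_gt1 he.
exists (octonion_bracket he); split.
- by split=> // br'; exact: shift_bracket_unique.
- split; last exact: octonion_bracket_special.
  split; [exact: octonion_bracket_malcev|exact: wl1_complete|by case: br_shift].
- exact: octonion_bracket_not_lie.
- by rewrite bracket_constant_octonion; split=> // X Y; exact: octonion_bracket_le.
- move=> c K _ _ _; rewrite bracket_constant_octonion /bch_radius mulrAC.
  by rewrite -natrM.
Qed.
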